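(* Let $(G,p)$ be an $r$-dimensional framework on $n$ vertices in $\mathbb{R}^r$, $r \le n-2$. Let $\Omega$ be a nonzero positive semidefinite stress matrix of $(G,p)$. Suppose that there does not exist a real vector $y=(y_{ij})_{\{i,j\}\in\overline{E}(G)}\neq\mathbf{0}$ with $$\Omega\Big(\sum_{\{i,j\}\in\overline{E}(G)} y_{ij}E^{ij}\Big)=\mathbf{0}.$$ Then $(G,p)$ is universally rigid.
   Context: A (bar) framework $(G,p)$ in $\mathbb{R}^r$ is a simple graph $G$ on vertices $1,\dots,n$ together with points $p^1,\dots,p^n\in\mathbb{R}^r$ (vertex $i$ is placed at $p^i$). Throughout, $G$ is connected and not complete. $(G,p)$ is $r$-dimensional if $p^1,\dots,p^n$ affinely span $\mathbb{R}^r$. $E(G)$ is the edge set of $G$ and $\overline{E}(G)=\{\{i,j\}: i\ne j,\ \{i,j\}\notin E(G)\}$ is the set of missing edges. Two frameworks $(G,p)$ and $(G,q)$ (on the same graph, possibly in Euclidean spaces of different dimensions) are equivalent if $\|p^i-p^j\|=\|q^i-q^j\|$ for every $\{i,j\}\in E(G)$. $(G,p)$ is universally rigid if for every framework $(G,q)$, in any dimension, that is equivalent to $(G,p)$, one has $\|p^i-p^j\|=\|q^i-q^j\|$ for all $i,j$. A stress of $(G,p)$ is a function $\omega:E(G)\to\mathbb{R}$ with $\sum_{j:\{i,j\}\in E(G)}\omega_{ij}(p^i-p^j)=\mathbf{0}$ for all $i$. The associated stress matrix is the $n\times n$ symmetric matrix $\Omega$ with $\Omega_{ij}=-\omega_{ij}$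 if $\{i,j\}\in E(G)$, $\Omega_{ij}=0$ if $\{i,j\}\in\overline{E}(G)$, and $\Omega_{ii}=\sum_{k:\{i,k\}\in E(G)}\omega_{ik}$. $E^{ij}$ is the $n\times n$ symmetric matrix with 1's in the $(i,j)$ and $(j,i)$ entries and 0's elsewhere. *)

(* Defs.v *)
From HB Require Import structures.
From mathcomp Require Import all_boot all_order all_algebra.
From mathcomp Require Import reals.

Set Implicit Arguments.
Unset Strict Implicit.
Unset Printing Implicit Defensive.

Import Order.TTheory GRing.Theory Num.Theory.
Local Open Scope ring_scope.

Record sgraph (n : nat) := SGraph {
  adj :> rel 'I_n;
  adj_sym : symmetric adj;
  adj_irr : irreflexive adj
}.

Definition missing (n : nat) (G : sgraph n) (i j : 'I_n) : bool :=
  (i != j) && ~~ G i j.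

Definition connected_graph (n : nat) (G : sgraph n) : Prop :=
  forall i j : 'I_n, connect G i j.

Definition complete_graph (n : nat) (G : sgraph n) : Prop :=
  forall i j : 'I_n, i != j -> G i j.

Definition config (R : realType) (n r : nat) := 'I_n -> 'rV[R]_r.

Definition enorm (R : realType) (r : nat) (v : 'rV[R]_r) : R :=
  Num.sqrt (\sum_(k < r) v 0 k ^+ 2).

Definition affinely_spans (R : realType) (n r : nat) (p : config R n r) : Prop :=
  forall x : 'rV[R]_r, exists a : 'I_n -> R,
    \sum_(i < n) a i = 1 /\ x = \sum_(i < n) a i *: p i.

Definition equivalent (R : realType) (n r s : nat) (G : sgraph n)
    (p : config R n r) (q : config R n s) : Prop :=
  forall i j : 'I_n, G i j -> enorm (p i - p j) = enorm (q i - q j).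

Definition universally_rigid (R : realType) (n r : nat) (G : sgraph n)
    (p : config R n r) : Prop :=
  forall (s : nat) (q : config R n s), equivalent G p q ->
    forall i j : 'I_n, enorm (p i - p j) = enorm (q i - q j).

(* A function on a set of unordered pairs of vertices (the edges, or the
   missing edges) is encoded by a total function on {set 'I_n}, evaluated only
   at the pairs [set i; j] of interest; its other values are irrelevant. *)
Definition pair_weight (R : realType) (n : nat) := {set 'I_n} -> R.

Definition is_stress (R : realType) (n r : nat) (G : sgraph n)
    (p : config R n r) (w : pair_weight R n) : Prop :=
  forall i : 'I_n, \sum_(j < n | G i j) w [set i; j] *: (p i - p j) = 0.

Definition stress_mx (R : realType) (n : nat) (G : sgraph n)
    (w : pair_weight R n) : 'M[R]_n :=
  \matrix_(i, j)
    if i == j then \sum_(k < n | G i k) w [set i; k]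
    else if G i j then - w [set i; j]
    else 0.

Definition is_stress_matrix (R : realType) (n r : nat) (G : sgraph n)
    (p : config R n r) (Omega : 'M[R]_n) : Prop :=
  exists w : pair_weight R n, is_stress G p w /\ Omega = stress_mx G w.

Definition psd (R : realType) (n : nat) (A : 'M[R]_n) : Prop :=
  A^T = A /\ forall x : 'cV[R]_n, 0 <= (x^T *m A *m x) 0 0.

(* Only used for i != j. *)
Definition Emx (R : realType) (n : nat) (i j : 'I_n) : 'M[R]_n :=
  delta_mx i j + delta_mx j i.

(* Each missing edge {i, j} is listed once, by its representative i < j. *)
Definition missing_mx (R : realType) (n : nat) (G : sgraph n)
    (y : pair_weight R n) : 'M[R]_n :=
  \sum_(i < n) \sum_(j < n | (i < j)%N && missing G i j)
    y [set i; j] *: Emx R i j.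

Definition nonzero_on_missing (R : realType) (n : nat) (G : sgraph n)
    (y : pair_weight R n) : Prop :=
  exists i j : 'I_n, missing G i j /\ y [set i; j] != 0.

(* Main.v *)
(** Let [D] be the difference of the squared-distance matrices of [q] and [p],
    where [q] is equivalent to [p]. It vanishes on the diagonal and on the
    edges, whereas [Omega] vanishes on the missing edges, so [Omega D] has zero
    diagonal. Its trace is [-2 tr (Omega Q Q^T)], since [Omega] kills [P] and
    the all-ones vector [e]; as [Omega] is positive semidefinite, [Omega Q = 0].
    Then [Omega D = v e^T] for some column [v], and the zero diagonal forces
    [v = 0]. Thus [D] is a combination of the [E^ij] killed by [Omega], hence
    [D = 0]. *)

Require Import Defs.
From HB Require Import structures.
From mathcomp Require Import all_boot all_order all_algebra.
From mathcomp Require Import reals.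
From mathcomp Require Import ring lra.

Set Implicit Arguments.
Unset Strict Implicit.
Unset Printing Implicit Defensive.

Import Order.TTheory GRing.Theory Num.Theory.
Local Open Scope ring_scope.

Lemma trmx_mul_self_eq0 (R : realDomainType) (n : nat) (x : 'cV[R]_n) :
  (x^T *m x) 0 0 = 0 -> x = 0.
Proof.
rewrite mxE => x0; apply/colP => i; rewrite mxE; apply/eqP.
rewrite -sqrf_eq0; apply/eqP.
have sq_ge0 j : true -> 0 <= x^T 0 j * x j 0 by rewrite mxE -expr2 sqr_ge0.
have /eqP := x0; rewrite psumr_eq0 // => /allP/(_ i (mem_index_enum _)) /eqP.
by rewrite mxE -expr2.
Qed.

(** A zero of a nonnegative form is a minimum, so the derivative at [x] in the direction [A *m x],
    twice the squared norm of [A *m x], must vanish. *)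
Lemma psd_mulmx_eq0 (R : realType) (n : nat) (A : 'M[R]_n) (x : 'cV[R]_n) :
  psd A -> (x^T *m A *m x) 0 0 = 0 -> A *m x = 0.
Proof.
move=> [symA posA] x0; apply: trmx_mul_self_eq0.
set y := A *m x; set N := (_ *m _) 0 0; set c := (y^T *m A *m y) 0 0.
have expand t : ((x + t *: y)^T *m A *m (x + t *: y)) 0 0
    = 2 * t * N + t ^+ 2 * c.
  (* By symmetry of [A] both cross terms equal [t * N]. *)
  have trA : x^T *m A = y^T by rewrite /y trmx_mul symA.
  have -> : (x + t *: y)^T = x^T + t *: y^T by rewrite linearD linearZ.
  have mxD00 (B C : 'M[R]_1) : (B + C) 0 0 = B 0 0 + C 0 0 by rewrite mxE.
  have mxZ00 a (B : 'M[R]_1) : (a *: B) 0 0 = a * B 0 0 by rewrite mxE.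
  rewrite !mulmxDl !mulmxDr -!scalemxAl -!scalemxAr !(mxD00, mxZ00) x0 trA.
  rewrite -(mulmxA y^T A x) -/y -/N -/c; ring.
have c_ge0 : 0 <= c by apply: posA.
(* Since [c] may vanish, [c + 1] serves as the denominator. *)
have c1_gt0 : 0 < c + 1 by lra.
(* [2 t N + t^2 c] is negative at [t = - N / (c + 1)] unless [N = 0]. *)
have := posA (x + (- (N / (c + 1))) *: y).
rewrite expand.
have -> : 2 * - (N / (c + 1)) * N + (- (N / (c + 1))) ^+ 2 * c
    = - ((N / (c + 1)) ^+ 2 * (c + 2)).
  by field; rewrite gt_eqF.
rewrite oppr_ge0 pmulr_lle0; last by lra.
move=> le0; have /eqP : (N / (c + 1)) ^+ 2 = 0.
  by apply/eqP; rewrite eq_le le0 sqr_ge0.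
by rewrite sqrf_eq0 mulf_eq0 invr_eq0 (gt_eqF c1_gt0) orbF => /eqP.
Qed.

(** By cyclicity the trace is the sum of the values of the form at the columns of [Q]; these are
    nonnegative, so each is zero. *)
Lemma psd_mxtrace_eq0 (R : realType) (n s : nat) (A : 'M[R]_n)
    (Q : 'M[R]_(n, s)) :
  psd A -> \tr (A *m (Q *m Q^T)) = 0 -> A *m Q = 0.
Proof.
move=> psdA; rewrite mulmxA mxtrace_mulC mulmxA => tr0.
have diagE k : ((col k Q)^T *m A *m col k Q) 0 0 = (Q^T *m A *m Q) k k.
  rewrite tr_col -row_mul !mxE.
  by apply: eq_bigr => i _; rewrite !mxE.
have diag_ge0 k : true -> 0 <= (Q^T *m A *m Q) k k.
  by rewrite -diagE; case: psdA => _ ->.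
apply/matrixP => i k.
have /eqP := tr0; rewrite /mxtrace psumr_eq0 //
  => /allP/(_ k (mem_index_enum _)).
rewrite -diagE => /eqP /(psd_mulmx_eq0 psdA) /colP /(_ i).
by rewrite colE mulmxA -colE !mxE.
Qed.

Section SquaredDistances.
Variables (R : realType) (n : nat).

Definition config_mx (s : nat) (q : config R n s) : 'M[R]_(n, s) :=
  \matrix_i q i.

Definition sqdist_mx (s : nat) (q : config R n s) : 'M[R]_n :=
  \matrix_(i, j) enorm (q i - q j) ^+ 2.

Definition sqnorm_col (s : nat) (q : config R n s) : 'cV[R]_n :=
  \col_i enorm (q i) ^+ 2.

Lemma enorm_sq (s : nat) (v : 'rV[R]_s) :
  enorm v ^+ 2 = \sum_(k < s) v 0 k ^+ 2.
Proof. by rewrite sqr_sqrtr // sumr_ge0 // => k _; rewrite sqr_ge0. Qed.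

(** This is the polarization of the squared distances: two rank-one terms and the Gram matrix. *)
Lemma sqdist_mxE (s : nat) (q : config R n s) :
  sqdist_mx q = sqnorm_col q *m const_mx 1 + const_mx 1 *m (sqnorm_col q)^T
    - 2 *: (config_mx q *m (config_mx q)^T).
Proof.
apply/matrixP => i j; rewrite !mxE !big_ord1 !mxE mulr1 mul1r !enorm_sq.
rewrite mulr_sumr -big_split -sumrB /=; apply: eq_bigr => k _.
by rewrite !mxE; ring.
Qed.

Variable A : 'M[R]_n.
Hypothesis symA : A^T = A.
Hypothesis A1 : A *m const_mx 1 = 0 :> 'cV_n.

(** Both rank-one terms have trace zero: one because [A] kills the constants, the other by cyclicity
    and symmetry of [A]. *)
Lemma mxtrace_mul_sqdist (s : nat) (q : config R n s) :
  \tr (A *m sqdist_mx q) = - 2 * \tr (A *m (config_mx q *m (config_mx q)^T)).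
Proof.
have A1T : const_mx 1 *m A = 0 :> 'rV_n.
  by rewrite -[LHS]trmxK trmx_mul symA trmx_const A1 trmx0.
rewrite sqdist_mxE mulmxBr mulmxDr !mulmxA A1 mul0mx addr0 -scalemxAr.
rewrite linearB linearZ /= mxtrace_mulC mulmxA A1T mul0mx mxtrace0 mulmxA.
by rewrite sub0r mulNr.
Qed.

Lemma mulmx_sqdist (s : nat) (q : config R n s) :
  A *m config_mx q = 0 ->
  A *m sqdist_mx q = A *m sqnorm_col q *m const_mx 1.
Proof.
move=> AQ; rewrite sqdist_mxE mulmxBr mulmxDr !mulmxA A1 mul0mx addr0.
by rewrite -scalemxAr mulmxA AQ mul0mx scaler0 subr0.
Qed.

End SquaredDistances.

Section StressMatrix.
Variables (R : realType) (n : nat) (G : sgraph n).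

(** The diagonal entry is the sum of the weights at [i], so it can be shared out among the
    neighbours of [i]. With the points as rows of [B], this is the equilibrium sum at [i]. *)
Lemma row_stress_mx_mul (m : nat) (w : pair_weight R n) (B : 'M[R]_(n, m))
    (i : 'I_n) :
  row i (stress_mx G w *m B)
    = \sum_(j < n | G i j) w [set i; j] *: (row i B - row j B).
Proof.
apply/rowP => k; rewrite !mxE summxE (bigD1 i) //= !mxE eqxx.
rewrite big_mkcond mulr_suml [in RHS]big_mkcond.
rewrite (bigD1 i) //= (adj_irr G i) mul0r add0r.
rewrite [RHS](bigD1 i) //= (adj_irr G i) add0r.
rewrite -big_split /=; apply: eq_bigr => j neq.
rewrite [stress_mx _ _ _ _]mxE eq_sym (negPf neq).
by case: (G i j); rewrite ?mul0r ?addr0 // !mxE; ring.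
Qed.

Lemma stress_mx_const (w : pair_weight R n) (a : R) :
  stress_mx G w *m const_mx a = 0 :> 'cV_n.
Proof.
apply/row_matrixP => i; rewrite row_stress_mx_mul row0 big1 // => j _.
by rewrite !row_const subrr scaler0.
Qed.

Lemma stress_mx_config (r : nat) (p : config R n r) (w : pair_weight R n) :
  is_stress G p w -> stress_mx G w *m config_mx p = 0.
Proof.
move=> wp; apply/row_matrixP => i; rewrite row_stress_mx_mul row0 -[RHS](wp i).
by apply: eq_bigr => j _; rewrite !rowK.
Qed.

(** The two matrices have complementary supports, so every term of the sum has a zero factor. *)
Lemma stress_mx_mul_diag (w : pair_weight R n) (D : 'M[R]_n) (i : 'I_n) :
  (forall i j, ~~ missing G i j -> D i j = 0) -> (stress_mx G w *m D) i i = 0.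
Proof.
move=> D0; rewrite mxE big1 // => j _; rewrite mxE.
have [<-|neq] := eqVneq i j; first by rewrite D0 ?mulr0 // /missing eqxx.
case: ifPn => [Gij|_]; last by rewrite mul0r.
by rewrite D0 ?mulr0 // /missing (adj_sym G j) Gij andbF.
Qed.

End StressMatrix.

Section MissingEdges.
Variables (R : realType) (n : nat) (G : sgraph n) (D : 'M[R]_n).
Hypothesis symD : D^T = D.
Hypothesis D0 : forall i j, ~~ missing G i j -> D i j = 0.

(* On a pair [set i; j] the double sum is D i j + D j i. *)
Definition pair_weight_of_mx : pair_weight R n :=
  fun S => 2^-1 * \sum_(i in S) \sum_(j in S) D i j.

Lemma pair_weight_of_mxE (i j : 'I_n) :
  i != j -> pair_weight_of_mx [set i; j] = D i j.
Proof.
move=> neq; have diag0 k : D k k = 0 by rewrite D0 // /missing eqxx.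
have Dji : D j i = D i j by rewrite -[in LHS]symD mxE.
rewrite /pair_weight_of_mx.
rewrite !big_setU1 ?inE //= !big_set1 !big_setU1 ?inE //= !big_set1.
rewrite !diag0 Dji; lra.
Qed.

Lemma missing_mx_pair_weight : missing_mx G pair_weight_of_mx = D.
Proof.
rewrite [RHS]matrix_sum_delta.
(* Split into the strict upper and lower triangles; the diagonal of [D] is zero. *)
have -> : \sum_i \sum_j D i j *: delta_mx i j
    = \sum_(i < n) \sum_(j < n | (i < j)%N) D i j *: delta_mx i j
      + \sum_(i < n) \sum_(j < n | (j < i)%N) D i j *: delta_mx i j :> 'M_n.
  rewrite -big_split /=; apply: eq_bigr => i _.
  rewrite (bigID (fun j : 'I_n => (i < j)%N)) /=; congr (_ + _).
  under eq_bigl do rewrite -leqNgt.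
  rewrite (bigD1 i) //= D0 ?scale0r ?add0r /missing ?eqxx //.
  by apply: eq_bigl => j; rewrite ltn_neqAle andbC.
(* Reindex the lower triangle by transposition, to pair [(i, j)] with [(j, i)]. *)
rewrite [X in _ + X](exchange_big_dep predT) //= -big_split /=.
apply: eq_bigr => i _; rewrite -big_split /= big_mkcondr; apply: eq_bigr => j lt_ij.
have Dji : D j i = D i j by rewrite -[in LHS]symD mxE.
rewrite Dji -scalerDr; case: ifPn => [/andP[neq _]|/D0 ->].
  by rewrite pair_weight_of_mxE.
by rewrite scale0r.
Qed.

End MissingEdges.

Theorem theorem4 (R : realType) (n r : nat) (G : sgraph n) (p : config R n r)
    (Omega : 'M[R]_n)
    (hconn : connected_graph G) (hncompl : ~ complete_graph G)
    (hdim : affinely_spans p) (hr : (r + 2 <= n)%N)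
    (hstress : is_stress_matrix G p Omega)
    (hnz : Omega != 0) (hpsd : psd Omega)
    (hy : ~ exists y : pair_weight R n,
            nonzero_on_missing G y /\ Omega *m missing_mx G y = 0) :
  universally_rigid G p.
Proof.
move=> s q eqpq i j; case: hstress => w [wp defOmega].
have [symO _] := hpsd.
have O1 : Omega *m const_mx 1 = 0 :> 'cV_n by rewrite defOmega stress_mx_const.
have OP : Omega *m config_mx p = 0 by rewrite defOmega stress_mx_config.
pose D := sqdist_mx q - sqdist_mx p.
have D0 a b : ~~ missing G a b -> D a b = 0.
  rewrite !mxE negb_and !negbK => /orP[/eqP->|Gab]; last by rewrite eqpq ?subrr.
  by rewrite !subrr !enorm_sq !big1 ?subrr // => k _; rewrite mxE expr0n.
have enormB t (c : config R n t) a b : enorm (c a - c b) = enorm (c b - c a).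
  congr (Num.sqrt _); apply: eq_bigr => k _.
  by rewrite -opprB mxE sqrrN.
have symD : D^T = D.
  by apply/matrixP => a b; rewrite !mxE (enormB _ q) (enormB _ p).
have diagOD a : (Omega *m D) a a = 0 by rewrite defOmega stress_mx_mul_diag.
have OQ : Omega *m config_mx q = 0.
  apply: psd_mxtrace_eq0 => //.
  have : \tr (Omega *m D) = 0 by rewrite /mxtrace big1.
  rewrite mulmxBr linearB /= !mxtrace_mul_sqdist // (mulmxA _ (config_mx p)) OP.
  by rewrite mul0mx mxtrace0; lra.
have OD : Omega *m D = 0.
  have [v defOD] : exists v : 'cV[R]_n, Omega *m D = v *m const_mx 1.
    (* [Omega] kills both configurations, so only the squared norms of the points survive. *)
    exists (Omega *m sqnorm_col q - Omega *m sqnorm_col p).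
    by rewrite mulmxBr !mulmx_sqdist // mulmxBl.
  suff v0 : v = 0 by rewrite defOD v0 mul0mx.
  by apply/colP => a; have := diagOD a; rewrite defOD mxE big_ord1 !mxE mulr1.
have Dij : D i j = 0.
  have [miss|/D0//] := boolP (missing G i j).
  (* Otherwise the entries of [D] on the missing edges form a nonzero [y] excluded by [hy]. *)
  apply/eqP/negPn/negP => Dij; apply: hy; exists (pair_weight_of_mx D).
  split; last by rewrite missing_mx_pair_weight.
  exists i, j; split=> //; have /andP[neq _] := miss.
  by rewrite (pair_weight_of_mxE symD D0).
move/eqP: Dij; rewrite !mxE subr_eq0 eqrXn2 ?sqrtr_ge0 // => /eqP ->//.
Qed.
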